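(* Let $A$ be a bounded selfadjoint operator in $\mathcal H$ and let $x\in\mathcal H$. Then the following statements are equivalent. (i) $(A^kx)_{k\in\mathbb N}$ is a Bessel sequence in $\mathcal H$. (ii) $\mu_x(\{t\in\mathbb R: |t|>1-\varepsilon\})=O(\varepsilon)$ as $\varepsilon\to 0$, $\varepsilon>0$. (iii) $\langle A^kx,x\rangle=O(k^{-1})$ as $k\to\infty$.
   Context: $\mathcal H$ is a complex Hilbert space with scalar product $\langle\cdot,\cdot\rangle$. $\mathbb N$ includes zero. A sequence $(y_k)_{k\in\mathbb N}$ in $\mathcal H$ is a Bessel sequence if there is $C>0$ such that $\sum_{k\in\mathbb N}|\langle y,y_k\rangle|^2\le C\|y\|^2$ for all $y\in\mathcal H$. $E$ denotes the spectral measure of $A$ and $\mu_x$ is the finite positive Borel measure $\mu_x(\Delta)=\langle E(\Delta)x,x\rangle=\|E(\Delta)x\|^2$. *)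

(* Defs.v *)
From HB Require Import structures.
From mathcomp Require Import all_boot all_order all_algebra.
From mathcomp Require Import sesquilinear complex ring.
From mathcomp Require Import all_classical all_reals all_analysis.
Set Implicit Arguments.
Unset Strict Implicit.
Unset Printing Implicit Defensive.
Import Order.TTheory GRing.Theory Num.Theory.
Import numFieldNormedType.Exports.
Local Open Scope classical_set_scope.
Local Open Scope ring_scope.
Local Open Scope complex_scope.

(* The scalar product is linear in its first argument and conjugate-linear in
   the second one. *)
HB.mixin Record CompleteNormedModule_isHilbert (R : realType) H
    & CompleteNormedModule R[i] H := {
  inner : {dot H for (@Num.conj R[i])} ;
  sqr_norm_inner : forall u : H, `|u| ^+ 2 = inner u u
}.

#[short(type="hilbertType")]
HB.structure Definition Hilbert (R : realType) :=
  {H of CompleteNormedModule_isHilbert R H & CompleteNormedModule R[i] H}.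

(* Norms in a normed module over R[i] are elements of R[i]; rnorm v is the same
   number as an element of R. *)
Definition rnorm (R : realType) (V : normedModType R[i]) (v : V) : R :=
  complex.Re `|v|.

Section rnorm.
Context {R : realType} {V : normedModType R[i]}.

Lemma rnormE (v : V) : `|v| = (rnorm v)%:C.
Proof. by rewrite /rnorm RRe_real. Qed.

Lemma cvg_rnorm (f : nat -> V) (v : V) :
  f n @[n --> \oo] --> v -> rnorm (f n) @[n --> \oo] --> rnorm v.
Proof.
move=> fv; apply/cvgrPdist_lt => e e0.
have eC0 : 0 < e%:C by rewrite ltcR.
have nfv : (`|f n| : R[i]^o) @[n --> \oo] --> (`|v| : R[i]^o) by exact: cvg_norm.
have nfve : \forall n \near \oo, `| `|v| - `|f n| | < e%:C.
  exact: (cvgrPdist_lt _ _).1 nfv _ eC0.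
apply: filterS nfve => n.
by rewrite !rnormE -rmorphB/= normc_def/= expr0n/= addr0 sqrtr_sqr ltcR.
Qed.

End rnorm.

Section operators.
Context {R : realType} {H : hilbertType R}.

Definition selfadjoint (A : H -> H) : Prop :=
  forall u v : H, inner (A u) v = inner u (A v).

Definition bessel_seq (y : nat -> H) : Prop :=
  exists2 C : R, 0 < C & forall v : H,
    (\sum_(0 <= k <oo) (rnorm (inner v (y k) : R[i]^o) ^+ 2)%:E <=
     (C * rnorm v ^+ 2)%:E)%E.

(* Measures on the Borel sets of the real line whose values are orthogonal
   projections, countably additive in the strong operator topology.  The values
   of sm_proj on sets that are not Borel play no role. *)
Record spectral_measure := SpectralMeasure {
  sm_proj :> set (measurableTypeR R) -> {linear H -> H} ;
  sm_idem : forall D, measurable D ->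
    forall u, sm_proj D (sm_proj D u) = sm_proj D u ;
  sm_selfadjoint : forall D, measurable D -> selfadjoint (sm_proj D) ;
  sm_set0 : forall u, sm_proj set0 u = 0 ;
  sm_setT : forall u, sm_proj setT u = u ;
  sm_sigma_additive : forall F : (set (measurableTypeR R))^nat,
    (forall n, measurable (F n)) -> trivIset setT F ->
    forall u, (\sum_(0 <= k < n) sm_proj (F k) u) @[n --> \oo] -->
              sm_proj (\bigcup_n F n) u
}.

(* mu_u(D) = |E(D) u|^2 = <E(D) u, u>, see sqr_rnormE; it takes finite values and
   is a measure on the Borel sets. *)
Definition scalar_measure (E : spectral_measure) (u : H)
    (D : set (measurableTypeR R)) : \bar R := (rnorm (E D u) ^+ 2)%:E.

Section scalar_measure.
Variables (E : spectral_measure) (u : H).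

Lemma sqr_rnormE (D : set (measurableTypeR R)) : measurable D ->
  (rnorm (E D u) ^+ 2)%:C = inner (E D u) u.
Proof.
by move=> mD; rewrite rmorphXn/= -rnormE sqr_norm_inner -sm_selfadjoint// sm_idem.
Qed.

Let mu0 : scalar_measure E u set0 = 0%E.
Proof. by rewrite /scalar_measure sm_set0 /rnorm normr0 expr0n. Qed.

Let mu_ge0 D : (0 <= scalar_measure E u D)%E.
Proof. by rewrite lee_fin sqr_ge0. Qed.

Let polar (a : R) (v : H) : inner v u = a%:C ->
  a = (rnorm (v + u) ^+ 2 - rnorm v ^+ 2 - rnorm u ^+ 2) / 2.
Proof.
move=> vu.
have uv : inner u v = a%:C.
  have -> : inner u v = Num.conj (inner v u).
    by rewrite [LHS](hermC inner) expr0 mul1r.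
  by rewrite vu; exact: conjc_real.
have : (rnorm (v + u) ^+ 2)%:C = (rnorm v ^+ 2 + rnorm u ^+ 2 + (a + a))%:C.
  rewrite !(rmorphXn, rmorphD)/= -!rnormE !sqr_norm_inner.
  by rewrite linearDl/= !linearDr/= vu uv; ring.
by move=> /complexI ->; field.
Qed.

Let mu_sigma : semi_sigma_additive (scalar_measure E u).
Proof.
move=> F mF tF mUF.
pose S n := \sum_(0 <= k < n) E (F k) u.
pose q (v : H) : R := (rnorm (v + u) ^+ 2 - rnorm v ^+ 2 - rnorm u ^+ 2) / 2.
have SE : S n @[n --> \oo] --> E (\bigcup_n F n) u by exact: sm_sigma_additive.
have sumq n : \sum_(0 <= k < n) rnorm (E (F k) u) ^+ 2 = q (S n).
  apply: polar; rewrite /S linear_sumlz rmorph_sum/=.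
  by apply: eq_bigr => k _; rewrite sqr_rnormE.
under eq_fun do rewrite /scalar_measure sumEFin sumq.
apply: cvg_EFin; first exact: nearW.
rewrite (polar (esym (sqr_rnormE mUF))).
apply: cvgMr_tmp; apply: cvgB; last exact: cvg_cst.
have sqc (w : nat -> R) (l : R) : w n @[n --> \oo] --> l ->
    w n ^+ 2 @[n --> \oo] --> l ^+ 2.
  by move=> wl; rewrite expr2; under eq_fun do rewrite expr2; exact: cvgM.
apply: cvgB; apply: sqc; apply: cvg_rnorm => //.
by apply: cvgD => //; exact: cvg_cst.
Qed.

HB.instance Definition _ := isMeasure.Build _ _ _ (scalar_measure E u)
  mu0 mu_ge0 mu_sigma.

End scalar_measure.

(* A is the integral of t with respect to E, in the weak sense: <A u, u> is the
   integral of t with respect to mu_u for every u.  By polarization this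
   determines A. *)
Definition spectral_measure_of (A : H -> H) (E : spectral_measure) : Prop :=
  forall u : H,
    (scalar_measure E u).-integrable setT (EFin \o (@idfun R)) /\
    inner (A u) u = (\int[scalar_measure E u]_t t)%:C.

End operators.

Arguments spectral_measure {R} H.

(* Main.v *)
Require Import Defs.
From HB Require Import structures.
From mathcomp Require Import all_boot all_order all_algebra.
From mathcomp Require Import sesquilinear complex.
From mathcomp Require Import all_classical all_reals all_analysis.
From mathcomp Require Import zify ring lra.
Import Order.TTheory GRing.Theory Num.Theory.
Import numFieldNormedType.Exports.
Local Open Scope classical_set_scope.
Local Open Scope ring_scope.
Set Implicit Arguments.
Unset Strict Implicit.
Unset Printing Implicit Defensive.

(* Write r n = |A^n x|.  Each of the three conditions is equivalent to
   r n ^ 2 = O(1/n).  For (iii) this is <A^(m+n) x, x> = <A^m x, A^n x> together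
   with Cauchy-Schwarz.
   For (i), testing the Bessel inequality on A^(2m) x bounds the sum of the
   r (m + i) ^ 4 by C r (2m) ^ 2, and r is nonincreasing because it is
   log-convex and tends to 0; conversely, by duality, the Bessel property is the
   boundedness on l^2 of the Gram matrix <A^(k+l) x, x> = O(1/(k+l+1)), i.e.
   Hilbert's inequality.
   For (ii), A commutes with E, so A expands by at least c on the ranges of
   E(]c, +oo[) and E(]-oo, -c[) and by at most c on the range of E([-c, c]).
   The expansion, with 1 - c = e of order 1/n, bounds the tails of mu_x by r n ^ 2.
   For the converse x is cut along the sets 1 - (j+1)/n < |t| <= 1 - j/n: the
   j-th piece has norm O(sqrt((j+1)/n)) and A^n shrinks it by e^(-j). *)

(** * Real sequences: log-convexity and Hilbert's inequality *)

Section real_sequences.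
Context {R : realType}.
Implicit Types (r c f : nat -> R).

(** One strict increase propagates to all later indices by log-convexity, so the fourth powers stay
    above a positive constant and their sums exceed [M]. *)
Lemma logconvex_nonincreasing r (M : R) : (forall n, 0 <= r n) ->
  (forall n, r n.+1 ^+ 2 <= r n * r n.+2) ->
  (forall n, \sum_(0 <= k < n) r k ^+ 4 <= M) ->
  nonincreasing_seq r.
Proof.
move=> r0 rlog rM; apply/nonincreasing_seqP => n; rewrite leNgt; apply/negP => rn.
have inc m : r (n + m)%N < r (n + m).+1.
  elim: m => [|m ih]; first by rewrite addn0.
  rewrite addnS; have := rlog (n + m)%N; have := r0 (n + m)%N; nra.
have lb m : r n.+1 <= r (n.+1 + m)%N.
  elim: m => [|m ih]; first by rewrite addn0.
  rewrite addnS; apply: (le_trans ih); rewrite addSn.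
  by have := inc m.+1; rewrite addnS; exact: ltW.
pose a := r n.+1 ^+ 4.
have a0 : 0 < a by rewrite exprn_gt0// (le_lt_trans (r0 n)).
have sumlb m : m%:R * a <= \sum_(0 <= k < n.+1 + m) r k ^+ 4.
  rewrite (big_cat_nat (n := n.+1)) ?leq_addr//=.
  apply: (@le_trans _ _ (\sum_(n.+1 <= k < n.+1 + m) a)).
    by rewrite sumr_const_nat addKn mulr_natl.
  rewrite -[leLHS]add0r; apply: lerD.
    by apply: sumr_ge0 => k _; rewrite exprn_ge0.
  apply: ler_sum_nat => k /andP[nk _]; rewrite -(subnKC nk).
  by apply: lerXn2r; rewrite ?nnegrE.
have := le_trans (sumlb (Num.truncn (M / a)).+1) (rM _).
by rewrite -ler_pdivlMr// leNgt truncnS_gt.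
Qed.

Lemma sum_even_le f m : (forall k, 0 <= f k) ->
  \sum_(0 <= i < m) f i.*2 <= \sum_(0 <= k < m.*2) f k.
Proof.
move=> f0; elim: m => [|m ih]; first by rewrite !big_nil.
by rewrite big_nat_recr//= doubleS !big_nat_recr//= -addrA lerD// lerDl.
Qed.

(* With p, q, s the square roots of l, l + 1, k + 1, the summand is at most
   (8 / s) (q / (q + s) - p / (p + s)), so the sum telescopes. *)
Lemma hilbert_matrix_schur (k n : nat) :
  \sum_(0 <= l < n) (Num.sqrt l.+1%:R * (k + l).+1%:R)^-1 <=
    8 / Num.sqrt k.+1%:R :> R.
Proof.
set s : R := Num.sqrt k.+1%:R.
have s0 : 0 < s by rewrite sqrtr_gt0.
have s2 : s ^+ 2 = k.+1%:R by rewrite sqr_sqrtr.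
pose g (l : nat) : R := Num.sqrt l%:R / (Num.sqrt l%:R + s).
have gl l : (Num.sqrt l.+1%:R * (k + l).+1%:R)^-1 <= 8 / s * (g l.+1 - g l).
  rewrite /g; set q : R := Num.sqrt l.+1%:R; set p : R := Num.sqrt l%:R.
  have q0 : 0 < q by rewrite sqrtr_gt0.
  have p0 : 0 <= p by rewrite sqrtr_ge0.
  have q2 : q ^+ 2 = l.+1%:R by rewrite sqr_sqrtr.
  have p2 : p ^+ 2 = l%:R by rewrite sqr_sqrtr.
  have qp2 : q ^+ 2 = p ^+ 2 + 1 by rewrite q2 p2 -natr1.
  have N : (k + l).+1%:R = s ^+ 2 + p ^+ 2 :> R by rewrite s2 p2 -natrD addSn.
  have pq : p <= q by nra.
  rewrite N.
  have -> : 8 / s * (q / (q + s) - p / (p + s)) = 8 * (q - p) / ((q + s) * (p + s)).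
    by field; rewrite !gt_eqF//; lra.
  have -> : q - p = 1 / (q + p).
    rewrite -[q - p](@mulfK _ (q + p)) ?gt_eqF//; last by lra.
    by congr (_ / _); rewrite -subr_sqr qp2 addrAC subrr add0r.
  (* The constant 8 is 2 * 4: [q + p] is at most [2 * q], and [h1] bounds [(q + s) * (p + s)] by
     [4 * (s ^+ 2 + p ^+ 2)], where [s1] absorbs the 1 in [q ^+ 2 = p ^+ 2 + 1]. *)
  have s1 : 1 <= s ^+ 2 by rewrite s2 ler1n.
  have -> : 8 * (1 / (q + p)) / ((q + s) * (p + s)) = 8 / ((q + p) * (q + s) * (p + s)).
    by field; rewrite !gt_eqF//; lra.
  rewrite -div1r ler_pdivrMr; last by rewrite mulr_gt0//; nra.
  rewrite mulrAC ler_pdivlMr; last by rewrite !mulr_gt0//; lra.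
  rewrite mul1r -mulrA.
  have h1 : (q + s) * (p + s) <= 4 * (s ^+ 2 + p ^+ 2).
    apply: (@le_trans _ _ ((q + s) * (q + s))); first by apply: ler_wpM2l; lra.
    have := sqr_ge0 (q - s); nra.
  apply: (@le_trans _ _ ((2 * q) * (4 * (s ^+ 2 + p ^+ 2)))); last by lra.
  by apply: ler_pM => //; [lra| apply: mulr_ge0; lra | lra].
apply: (@le_trans _ _ (\sum_(0 <= l < n) 8 / s * (g l.+1 - g l))).
  by apply: ler_sum_nat => l _; exact: gl.
rewrite -mulr_sumr telescope_sumr//.
rewrite -[leRHS]mulr1; apply: ler_wpM2l; first by rewrite divr_ge0// ltW.
rewrite /g sqrtr0 mul0r subr0 ler_pdivrMr ?ltr_wpDl ?sqrtr_ge0//; lra.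
Qed.

(** Schur's test with weights [w]: the inequality between arithmetic and geometric means splits each
    term into [F k l] and its mirror image, and [hilbert_matrix_schur] bounds the weighted row sums
    by [8 / w k]. *)
Lemma hilbert_inequality c n :
  \sum_(0 <= k < n) \sum_(0 <= l < n) c k * c l / (k + l).+1%:R <=
    8 * \sum_(0 <= k < n) c k ^+ 2.
Proof.
pose w (k : nat) : R := Num.sqrt k.+1%:R.
have w0 k : 0 < w k by rewrite sqrtr_gt0.
pose F k l := c k ^+ 2 * w k * (w l * (k + l).+1%:R)^-1.
have FF k l : c k * c l / (k + l).+1%:R <= 2^-1 * (F k l + F l k).
  rewrite /F (addnC l k); set N : R := (k + l).+1%:R.
  have N0 : 0 < N by rewrite ltr0n.
  rewrite -subr_ge0.
  have -> : 2^-1 * (c k ^+ 2 * w k * (w l * N)^-1 + c l ^+ 2 * w l * (w k * N)^-1)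
     - c k * c l / N = (c k * w k - c l * w l) ^+ 2 / (2 * (w k * w l * N)).
    by field; rewrite !gt_eqF.
  by rewrite divr_ge0 ?sqr_ge0// !mulr_ge0// ltW.
have sumF : \sum_(0 <= k < n) \sum_(0 <= l < n) F k l <= 8 * \sum_(0 <= k < n) c k ^+ 2.
  rewrite mulr_sumr; apply: ler_sum_nat => k _; rewrite -mulr_sumr.
  apply: (@le_trans _ _ (c k ^+ 2 * w k * (8 / w k))).
    by apply: ler_wpM2l; [rewrite mulr_ge0 ?sqr_ge0// ltW|exact: hilbert_matrix_schur].
  by rewrite le_eqVlt; apply/orP; left; apply/eqP; field; rewrite gt_eqF.
apply: le_trans sumF.
apply: (@le_trans _ _ (\sum_(0 <= k < n) \sum_(0 <= l < n) 2^-1 * (F k l + F l k))).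
  by do 2 (apply: ler_sum_nat => ? _); exact: FF.
under eq_bigr do rewrite -mulr_sumr big_split/=.
rewrite -mulr_sumr big_split/= [X in _ + X]exchange_big_nat//=.
by rewrite le_eqVlt; apply/orP; left; apply/eqP; field.
Qed.

End real_sequences.

(** * The real part of the scalar product as a real bilinear form *)

Section real_inner_product.
Context {R : realType} {H : hilbertType R}.
Implicit Types u v w : H.

Definition rdot u v : R := complex.Re (inner u v).

Lemma rdotDl u v w : rdot (u + v) w = rdot u w + rdot v w.
Proof. by rewrite /rdot linearDl raddfD. Qed.

Lemma rdotDr u v w : rdot w (u + v) = rdot w u + rdot w v.
Proof. by rewrite /rdot linearDr raddfD. Qed.

Lemma rdotNl u v : rdot (- u) v = - rdot u v.
Proof. by rewrite /rdot linearNl raddfN. Qed.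

Lemma rdotNr u v : rdot u (- v) = - rdot u v.
Proof. by rewrite /rdot linearNr raddfN. Qed.

Lemma innerC u v : inner u v = Num.conj (inner v u).
Proof. by rewrite [LHS](hermC inner) expr0 mul1r. Qed.

Lemma rdotC u v : rdot u v = rdot v u.
Proof. by rewrite /rdot innerC; case: (inner v u). Qed.

Lemma inner_sqr_rnorm u : inner u u = ((rnorm u ^+ 2)%:C)%C.
Proof. by rewrite rmorphXn/= -rnormE sqr_norm_inner. Qed.

Lemma rdotE u : rdot u u = rnorm u ^+ 2.
Proof. by rewrite /rdot inner_sqr_rnorm. Qed.

Lemma rdotZl (a : R) u v : rdot (a%:C%C *: u) v = a * rdot u v.
Proof.
rewrite /rdot linearZl_LR/=; case: (inner u v) => p q /=.
by rewrite mul0r subr0.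
Qed.

Lemma rdotZr (a : R) u v : rdot u (a%:C%C *: v) = a * rdot u v.
Proof. by rewrite rdotC rdotZl rdotC. Qed.

Definition rdot_linE := (rdotDl, rdotDr, rdotNl, rdotNr, rdotZl, rdotZr).

End real_inner_product.

(** * Real-valued norms of vectors and of complex scalars *)

Section norms.
Context {R : realType}.
Implicit Types z : R[i].

Lemma rnorm_ge0 (V : normedModType R[i]) (v : V) : 0 <= rnorm v.
Proof. by rewrite -lecR -rnormE; exact: normr_ge0. Qed.

Lemma rnorm0 (V : normedModType R[i]) : rnorm (0 : V) = 0.
Proof. by rewrite /rnorm normr0. Qed.

Lemma rnorm0_eq0 (V : normedModType R[i]) (v : V) : rnorm v = 0 -> v = 0.
Proof. by move=> v0; apply/eqP; rewrite -normr_eq0 rnormE v0. Qed.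

Lemma rnormZ (V : normedModType R[i]) z (v : V) :
  rnorm (z *: v) = rnorm (z : R[i]^o) * rnorm v.
Proof. by apply: complexI; rewrite rmorphM/= -!rnormE normrZ. Qed.

Lemma rnormM z1 z2 :
  rnorm (z1 * z2 : R[i]^o) = rnorm (z1 : R[i]^o) * rnorm (z2 : R[i]^o).
Proof. exact: rnormZ. Qed.

Lemma rnormD (V : normedModType R[i]) (u v : V) : rnorm (u + v) <= rnorm u + rnorm v.
Proof. by rewrite -lecR rmorphD/= -!rnormE ler_normD. Qed.

Lemma ler_rnorm_sum (V : normedModType R[i]) (f : nat -> V) n :
  rnorm (\sum_(0 <= k < n) f k) <= \sum_(0 <= k < n) rnorm (f k).
Proof.
elim: n => [|n ih]; first by rewrite !big_nil rnorm0.
by rewrite !big_nat_recr//= (le_trans (rnormD _ _))// lerD2r.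
Qed.

Lemma rnorm_real (a : R) : rnorm (a%:C%C : R[i]^o) = `|a|.
Proof. by rewrite /rnorm normc_def/= expr0n addr0 sqrtr_sqr. Qed.

Lemma rnorm_conj z : rnorm (Num.conj z : R[i]^o) = rnorm (z : R[i]^o).
Proof. by rewrite /rnorm norm_conjC. Qed.

Lemma Re_le_rnorm z : `|complex.Re z| <= rnorm (z : R[i]^o).
Proof. by rewrite -lecR -rnormE; exact: normc_ge_Re. Qed.

Lemma mul_conj_rnorm z : Num.conj z * z = ((rnorm (z : R[i]^o) ^+ 2)%:C)%C.
Proof. by rewrite mulrC -normCK rmorphXn/= -rnormE. Qed.

End norms.

(** * The Cauchy-Schwarz inequality *)

Section cauchy_schwarz.
Context {R : realType} {H : hilbertType R}.
Implicit Types u v w : H.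

Lemma rdot_le u v : rdot u v <= rnorm u * rnorm v.
Proof.
have [v0|v0] := eqVneq (rnorm v) 0.
  by rewrite (rnorm0_eq0 v0) rnorm0 mulr0 /rdot linear0r.
have vp : 0 < rnorm v by rewrite lt_neqAle eq_sym v0 rnorm_ge0.
(* This is |v|^2 times the component of [u] orthogonal to [v] for [rdot]. *)
pose w := ((rnorm v ^+ 2)%:C%C *: u) + ((- rdot u v)%:C%C *: v).
have : 0 <= rdot w w by rewrite rdotE sqr_ge0.
have -> : rdot w w = rnorm v ^+ 2 * ((rnorm u * rnorm v) ^+ 2 - rdot u v ^+ 2).
  by rewrite /w !rdot_linE !rdotE (rdotC v u); ring.
rewrite pmulr_rge0 ?exprn_gt0// subr_ge0 => h.
have [uv|/ltW uv] := leP 0 (rdot u v).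
  by rewrite -(ler_pXn2r (ltn0Sn 1)) ?nnegrE// mulr_ge0// rnorm_ge0.
by apply: (le_trans uv); rewrite mulr_ge0// rnorm_ge0.
Qed.

(** Multiplying [u] by the conjugate of z = <u, v> turns the scalar product into the real number
    |z|^2, which reduces the complex bound to the real one. *)
Lemma rnorm_inner_le u v : rnorm (inner u v : R[i]^o) <= rnorm u * rnorm v.
Proof.
set z := inner u v; have [z0|z0] := eqVneq (rnorm (z : R[i]^o)) 0.
  by rewrite z0 mulr_ge0// rnorm_ge0.
have zp : 0 < rnorm (z : R[i]^o) by rewrite lt_neqAle eq_sym z0 rnorm_ge0.
have zz : rnorm (z : R[i]^o) * rnorm (z : R[i]^o) = rdot (Num.conj z *: u) v.
  by rewrite /rdot linearZl_LR/= mul_conj_rnorm/= expr2.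
rewrite -(ler_pM2l zp) zz; apply: (le_trans (rdot_le _ _)).
by rewrite rnormZ rnorm_conj mulrA.
Qed.

End cauchy_schwarz.

(** * The O conditions as explicit uniform bounds *)

Section asymptotics.
Context {R : realType}.

(** The denominator [n.+1] includes [n = 0] in the uniform bound, where the comparison function
    takes the value [0^-1 = 0]. *)
Lemma bigO_inv_natP (f : nat -> R[i]^o) :
  f =O_\oo (fun k : nat => k%:R^-1 : R[i]^o) <->
  exists K : R, forall n, rnorm (f n) <= K / n.+1%:R.
Proof.
rewrite eqO_exP; split.
  move=> [k k0 [N _ Nk]].
  have [k' kE] : exists k' : R, k = (k'%:C)%C.
    by exists (complex.Re k); rewrite RRe_real// realE ltW.
  have k'0 : 0 < k' by rewrite -ltcR -kE.
  (* The sum covers the indices up to [N]; beyond them [n] is positive, and [n.+1 <= 2 * n] accounts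
     for [2 * k']. *)
  exists (2 * k' + \sum_(0 <= m < N.+1) rnorm (f m) * m.+1%:R) => n.
  rewrite ler_pdivlMr//.
  have S0 a b : 0 <= \sum_(a <= m < b) rnorm (f m) * m.+1%:R.
    by apply: sumr_ge0 => m _; rewrite mulr_ge0// rnorm_ge0.
  have [nN|Nn] := leqP n N.
    apply: (@le_trans _ _ (\sum_(0 <= m < N.+1) rnorm (f m) * m.+1%:R)).
      rewrite (big_cat_nat (n := n))//=; last exact: leqW.
      by rewrite [X in _ + X]big_ltn// -[leLHS]add0r lerD// lerDl.
    by rewrite lerDr; lra.
  have n0 : (0 < n)%N by exact: leq_trans Nn.
  have /Nk : (N <= n)%N by exact: ltnW.
  rewrite normrV ?unitfE ?pnatr_eq0 -?lt0n// ger0_norm ?ler0n// kE.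
  rewrite rnormE -(rmorph_nat (@real_complex R)) -fmorphV -rmorphM/= lecR.
  rewrite ler_pdivlMr ?ltr0n// => h.
  apply: (@le_trans _ _ (2 * k')); last by rewrite lerDl.
  rewrite -natr1 mulrDr mulr1.
  have : rnorm (f n) <= rnorm (f n) * n%:R.
    by rewrite ler_peMr ?rnorm_ge0// ler1n.
  lra.
move=> [K fK]; exists ((`|K| + 1)%:C)%C; first by rewrite ltcR ltr_wpDl.
exists 1%N => //= n n0.
rewrite normrV ?unitfE ?pnatr_eq0 -?lt0n// ger0_norm ?ler0n//.
rewrite rnormE -(rmorph_nat (@real_complex R)) -fmorphV -rmorphM/= lecR.
apply: (le_trans (fK n)); apply: (@le_trans _ _ ((`|K| + 1) / n.+1%:R)).
  by rewrite ler_pM2r ?invr_gt0// (le_trans (ler_norm K))// lerDl.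
by rewrite ler_wpM2l ?addr_ge0// lef_pV2 ?posrE ?ltr0n// ler_nat.
Qed.

(** Boundedness of [m] extends the bound near 0 to all positive [e]: beyond the radius [d], [M] is
    at most [M / d * e]. *)
Lemma bigO_right0P (m : R -> R) (M : R) : (forall e, 0 <= m e <= M) ->
  m =O_ ((0 : R)^'+) (fun e : R => e) <->
  exists K : R, forall e, 0 < e -> m e <= K * e.
Proof.
move=> mM; have M0 : 0 <= M by have /andP[a b] := mM 0; exact: le_trans b.
rewrite eqO_exP; split.
  move=> [k k0 /nbhs_ballP[d /= d0 kd]].
  exists (k + M / d) => e e0; have /andP[m0 mle] := mM e.
  have Md : 0 <= M / d by rewrite divr_ge0// ltW.
  have [ed|de] := ltP e d.
    have : `|m e| <= k * `|e|.
      by apply: kd => //=; rewrite /ball/= sub0r normrN gtr0_norm.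
    rewrite ger0_norm// gtr0_norm// => /le_trans; apply.
    by rewrite ler_wpM2r ?lerDl// ltW.
  apply: (le_trans mle); rewrite mulrDl.
  have : M <= M / d * e by rewrite mulrAC ler_pdivlMr// ler_wpM2l.
  have : 0 <= k * e by rewrite mulr_ge0// ltW.
  lra.
move=> [K mK]; exists (`|K| + 1); first by rewrite ltr_wpDl.
near=> e.
have e0 : 0 < e by near: e; exact: nbhs_right_gt.
have /andP[m0 _] := mM e.
rewrite (ger0_norm m0) (gtr0_norm e0); apply: (le_trans (mK e e0)).
by rewrite ler_wpM2r ?(ltW e0)// (le_trans (ler_norm K))// lerDl.
Unshelve. all: by end_near. Qed.

End asymptotics.

(** * Norms and moments of the iterates, and the Bessel property *)

Section bessel_iterates.
Context {R : realType} {H : hilbertType R}.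
Variables (A : {linear H -> H}).
Hypothesis A_selfadjoint : selfadjoint A.
Variable x : H.

Let y k := iter k A x.
Let r k := rnorm (y k).

Let r_ge0 k : 0 <= r k. Proof. exact: rnorm_ge0. Qed.

Lemma inner_iter m n : inner (iter m A x) (iter n A x) = inner (iter (m + n) A x) x.
Proof.
elim: n m => [|n ih] m; first by rewrite addn0.
by rewrite [iter n.+1 _ _]iterS -A_selfadjoint -iterS ih addSnnS.
Qed.

(** The Gram matrix of the iterates is a Hankel matrix, so an even index sum can be redistributed
    into two equal halves. *)
Lemma inner_iter_even m n k : (m + n)%N = k.*2 ->
  inner (iter m A x) (iter n A x) = ((r k ^+ 2)%:C)%C.
Proof. by move=> mn; rewrite inner_iter mn -addnn -inner_iter inner_sqr_rnorm. Qed.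

(** Cauchy-Schwarz for <A^k x, A^(k+2) x>, which equals |A^(k+1) x|^2. *)
Lemma rnorm_iter_logconvex k : r k.+1 ^+ 2 <= r k * r k.+2.
Proof.
apply: le_trans (rdot_le _ _).
by rewrite /rdot (@inner_iter_even _ _ k.+1) //= addnS addnS addnn.
Qed.

Lemma moments_decayP :
  (exists K : R, forall n, rnorm (inner (iter n A x) x : R[i]^o) <= K / n.+1%:R) <->
  (exists K : R, forall n, rnorm (iter n A x) ^+ 2 <= K / n.+1%:R).
Proof.
split=> -[K hK].
  have K0 : 0 <= K by have := hK 0%N; rewrite divr1; apply: le_trans; exact: rnorm_ge0.
  exists K => n; have := hK n.*2.
  rewrite -addnn -inner_iter inner_sqr_rnorm rnorm_real ger0_norm ?sqr_ge0//.
  move=> /le_trans; apply.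
  by rewrite ler_wpM2l// lef_pV2 ?posrE ?ltr0n// ler_nat ltnS leq_addr.
have K0 : 0 <= K by have := hK 0%N; rewrite divr1; apply: le_trans; exact: sqr_ge0.
exists (2 * K) => n.
have nE : n = (n./2 + uphalf n)%N by rewrite uphalf_half addnCA addnn odd_double_half.
rewrite {1}nE -inner_iter; apply: (le_trans (rnorm_inner_le _ _)).
apply: (@le_trans _ _ ((r n./2 ^+ 2 + r (uphalf n) ^+ 2) / 2)).
  by have := sqr_ge0 (r n./2 - r (uphalf n)); rewrite /r /y; nra.
(* Both halves of [n] are at least [n./2], hence [n.+1 <= 2 * m.+1]; this is the factor 2 of the
   witness. *)
have half_le m : (n./2 <= m)%N -> r m ^+ 2 <= 2 * K / n.+1%:R.
  move=> nm; apply: (le_trans (hK m)).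
  rewrite ler_pdivrMr ?ltr0n// mulrAC ler_pdivlMr ?ltr0n// mulrAC mulrC ler_wpM2r//.
  rewrite -natrM ler_nat.
  by move: nm; lia.
have := half_le _ (leqnn _); have := half_le (uphalf n).
rewrite uphalf_half leq_addl => /(_ isT); move: (2 * K / n.+1%:R) => b; lra.
Qed.

Lemma bessel_seq_partial (C : R) (v : H) n :
  (\sum_(0 <= k <oo) (rnorm (inner v (y k) : R[i]^o) ^+ 2)%:E <=
     (C * rnorm v ^+ 2)%:E)%E ->
  \sum_(0 <= k < n) rnorm (inner v (y k) : R[i]^o) ^+ 2 <= C * rnorm v ^+ 2.
Proof.
move=> hC; rewrite -lee_fin -sumEFin; apply: le_trans hC.
by apply: nneseries_lim_ge => k _ _; rewrite lee_fin sqr_ge0.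
Qed.

Lemma bessel_rnorm_decay : bessel_seq y ->
  exists K : R, forall n, rnorm (iter n A x) ^+ 2 <= K / n.+1%:R.
Proof.
move=> [C C0 yC].
(* Only the even indices 2i are kept in the Bessel sum for A^(2m) x, since <A^(2m) x, A^(2i) x> = r
   (m + i) ^ 2. *)
have even_sum m n : \sum_(0 <= i < n) r (m + i)%N ^+ 4 <= C * r m.*2 ^+ 2.
  apply: (le_trans _ (bessel_seq_partial n.*2 (yC (y m.*2)))).
  pose f k := rnorm (inner (y m.*2) (y k) : R[i]^o) ^+ 2.
  apply: le_trans (@sum_even_le _ f _ _).
    apply: ler_sum_nat => i _.
    rewrite /f (@inner_iter_even _ _ (m + i)) ?doubleD// rnorm_real.
    by rewrite ger0_norm ?sqr_ge0// -exprM.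
  by move=> k; exact: sqr_ge0.
have r_dec : nonincreasing_seq r.
  by apply: logconvex_nonincreasing rnorm_iter_logconvex (even_sum 0%N).
(* For [i <= m] the index [m + i] does not exceed [m.*2], so by monotonicity each of the [m.+1]
   summands is at least [r m.*2 ^+ 4]; a factor [r m.*2 ^+ 2] then cancels. *)
have even_decay m : m.+1%:R * r m.*2 ^+ 2 <= C.
  have [->|rm] := eqVneq (r m.*2) 0; first by rewrite expr0n mulr0 ltW.
  have rm0 : 0 < r m.*2 ^+ 2 by rewrite exprn_gt0// lt_neqAle eq_sym rm r_ge0.
  rewrite -(ler_pM2r rm0) -mulrA -exprD; apply: le_trans (even_sum m m.+1).
  rewrite mulr_natl -[X in _ *+ X](subn0 m.+1) -sumr_const_nat.
  apply: ler_sum_nat => i /andP[_ im].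
  by apply: lerXn2r; rewrite ?nnegrE//; apply: r_dec; rewrite -addnn leq_add2l.
exists (2 * C) => n; rewrite ler_pdivlMr ?ltr0n//.
have := even_decay n./2.
have : r n ^+ 2 <= r n./2.*2 ^+ 2.
  apply: lerXn2r; rewrite ?nnegrE//; apply: r_dec.
  by rewrite -{2}(odd_double_half n) leq_addl.
have : n.+1%:R <= 2 * n./2.+1%:R :> R.
  by rewrite -natrM ler_nat; lia.
rewrite -/(r n); have := r_ge0 n; have := sqr_ge0 (r n); have : 0 <= n.+1%:R :> R by [].
have : 0 <= n./2.+1%:R :> R by [].
nra.
Qed.

Lemma moments_decay_bessel :
  (exists K : R, forall n, rnorm (inner (iter n A x) x : R[i]^o) <= K / n.+1%:R) ->
  bessel_seq y.
Proof.
move=> [K hK].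
have K0 : 0 <= K by have := hK 0%N; rewrite divr1; apply: le_trans; exact: rnorm_ge0.
(* The 1 keeps the Bessel constant positive when [K = 0]. *)
exists (8 * K + 1) => [|v]; first by lra.
apply: lime_le.
  by apply: is_cvg_nneseries => k _ _; rewrite lee_fin sqr_ge0.
apply: nearW => n; rewrite sumEFin lee_fin.
pose c k : R[i] := inner v (y k).
(* Duality: <v, w> = S, while Hilbert's inequality gives |w|^2 <= 8 K S. One factor [S] then cancels
   from S^2 <= |v|^2 |w|^2. *)
pose w := \sum_(0 <= k < n) c k *: y k.
set S := \sum_(0 <= k < n) _.
have S0 : 0 <= S by apply: sumr_ge0 => k _; exact: sqr_ge0.
have Sw : S <= rnorm v * rnorm w.
  apply: le_trans (rdot_le _ _).
  rewrite /rdot /w linear_sumr raddf_sum/= /S.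
  apply: ler_sum_nat => k _.
  by rewrite linearZr_LR/= mul_conj_rnorm.
have wS : rnorm w ^+ 2 <= 8 * K * S.
  rewrite -rdotE /rdot {1}/w linear_sumlz raddf_sum/=.
  apply: (@le_trans _ _ (K * \sum_(0 <= k < n) \sum_(0 <= l < n)
     rnorm (c k : R[i]^o) * rnorm (c l : R[i]^o) / (k + l).+1%:R)); last first.
    by rewrite -mulrA [leRHS]mulrCA ler_wpM2l// hilbert_inequality.
  rewrite mulr_sumr; apply: ler_sum_nat => k _.
  rewrite /w linear_sumr raddf_sum/= mulr_sumr; apply: ler_sum_nat => l _.
  rewrite linearZl_LR linearZr_LR/= inner_iter.
  apply: (le_trans (ler_norm _)); apply: (le_trans (Re_le_rnorm _)).
  rewrite !rnormM rnorm_conj [leRHS]mulrCA -!mulrA.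
  rewrite ler_wpM2l ?rnorm_ge0// ler_wpM2l ?rnorm_ge0//.
have [->|Sn0] := eqVneq S 0; first by rewrite mulr_ge0 ?sqr_ge0//; lra.
have Sp : 0 < S by rewrite lt_neqAle eq_sym Sn0.
have SS : S ^+ 2 <= rnorm v ^+ 2 * rnorm w ^+ 2.
  by rewrite -exprMn; apply: lerXn2r; rewrite ?nnegrE// mulr_ge0// rnorm_ge0.
rewrite -(ler_pM2r Sp) -expr2; apply: (le_trans SS).
rewrite [leRHS]mulrAC mulrC ler_wpM2r ?sqr_ge0//; apply: (le_trans wS); nra.
Qed.

End bessel_iterates.

(** * Calculus of projection-valued measures *)

Section spectral_projections.
Context {R : realType} {H : hilbertType R}.
Variable E : spectral_measure H.
Implicit Types (D S : set (measurableTypeR R)) (u v : H).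

(** Countable additivity for the sequence [D], [S], empty, empty, ...: the partial sums are constant
    from index 2 on. *)
Lemma sm_setU D S u : measurable D -> measurable S -> D `&` S = set0 ->
  E (D `|` S) u = E D u + E S u.
Proof.
move=> mD mS DS0.
have mF n : measurable (bigcup2 D S n).
  by case: n => [//|[//|n]]; exact: measurable0.
have tF : trivIset setT (bigcup2 D S) by rewrite -trivIset_bigcup2.
have EU : (\sum_(0 <= k < n) E (bigcup2 D S k) u) @[n --> \oo] --> E (D `|` S) u.
  by rewrite -bigcup2E; exact: sm_sigma_additive.
apply: (cvg_unique _ EU); first exact: norm_hausdorff.
apply: cvg_near_cst; exists 2%N => // n /= n2.
rewrite (big_cat_nat (n := 2))//= big_ltn// big_ltn// big_geq// addr0.
rewrite big_nat_cond big1 ?addr0// => -[|[|k]]//= _.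
by rewrite sm_set0.
Qed.

Lemma rdot_sm D u v : measurable D -> rdot (E D u) v = rdot u (E D v).
Proof. by move=> mD; rewrite /rdot (sm_selfadjoint E mD). Qed.

Lemma rnorm_sm_le D u : measurable D -> rnorm (E D u) <= rnorm u.
Proof.
move=> mD; have [->|Eu0] := eqVneq (rnorm (E D u)) 0; first exact: rnorm_ge0.
have Eup : 0 < rnorm (E D u) by rewrite lt_neqAle eq_sym Eu0 rnorm_ge0.
by rewrite -(ler_pM2l Eup) -expr2 -rdotE rdot_sm// sm_idem// mulrC rdot_le.
Qed.

Lemma sm_disjoint D S u : measurable D -> measurable S -> D `&` S = set0 ->
  E D (E S u) = 0.
Proof.
move=> mD mS DS0; set v := E S u.
have mU : measurable (D `|` S) by exact: measurableU.
have Uv : rnorm (E (D `|` S) v) ^+ 2 = rnorm (E D v) ^+ 2 + rnorm v ^+ 2.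
  rewrite -rdotE rdot_sm// sm_idem// sm_setU// /v sm_idem// rdotDr rdotE.
  by rewrite -{1}(sm_idem E mD) -rdot_sm// rdotE addrC.
(* Otherwise the projection E (D `|` S) would lengthen v. *)
have := rnorm_sm_le v mU; rewrite -(ler_pXn2r (ltn0Sn 1)) ?nnegrE ?rnorm_ge0// Uv.
rewrite gerDr => Ev0; apply: rnorm0_eq0; apply/eqP.
by rewrite -sqrf_eq0 eq_le Ev0 sqr_ge0.
Qed.

Lemma sm_setIC D S u : measurable D -> measurable S ->
  E D u = E (D `&` S) u + E (D `&` ~` S) u.
Proof.
move=> mD mS; rewrite -sm_setU.
- by rewrite -setIUr setUv setIT.
- exact: measurableI.
- by apply: measurableI => //; exact: measurableC.
- by rewrite setIACA setICr setI0.
Qed.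

(** Multiplicativity is not a field of the record. Splitting [D] along [S] and then [S] along [D]
    leaves only the common part, as [sm_disjoint] kills the cross terms. *)
Lemma smI D S u : measurable D -> measurable S -> E D (E S u) = E (D `&` S) u.
Proof.
move=> mD mS.
have mDS : measurable (D `&` S) by exact: measurableI.
have mDCS : measurable (D `&` ~` S) by apply: measurableI => //; exact: measurableC.
have mSCD : measurable (S `&` ~` D) by apply: measurableI => //; exact: measurableC.
rewrite (sm_setIC _ mD mS) (@sm_disjoint (D `&` ~` S))// ?addr0; last first.
  by rewrite -setIA setICl setI0.
rewrite (sm_setIC u mS mD) linearD setIC sm_idem 1?setIC//.
rewrite [X in _ + X]sm_disjoint ?addr0//.
by rewrite (setIC D) setIACA setICr setI0.
Qed.

Lemma sm_decomp D u : measurable D -> u = E D u + E (~` D) u.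
Proof.
by move=> mD; rewrite -{1}(sm_setT E u) (sm_setIC u measurableT mD) !setTI.
Qed.

(* The ranges of E D and E (~` D) are invariant under E, hence the scalar
   measures add up along the orthogonal decomposition they define. *)
Lemma scalar_measureD D S u v : measurable D -> measurable S ->
  E D u = u -> E (~` D) v = v ->
  (scalar_measure E (u + v)%R S = scalar_measure E u S + scalar_measure E v S)%E.
Proof.
move=> mD mS Du Dv; have mCD : measurable (~` D) by exact: measurableC.
rewrite /scalar_measure -EFinD; congr EFin.
rewrite -!rdotE linearD !rdot_linE (rdotC (E S v)).
suff -> : rdot (E S u) (E S v) = 0 by rewrite addr0 add0r.
rewrite rdot_sm// sm_idem// -Dv smI// setIC -smI// -rdot_sm// -Du sm_disjoint//.
  by rewrite /rdot linear0l.
by rewrite setICl.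
Qed.

End spectral_projections.

(** * The operator on the ranges of its spectral projections *)

Section spectral_operator.
Context {R : realType} {H : hilbertType R}.
Variables (A : {linear H -> H}) (E : spectral_measure H).
Hypotheses (A_selfadjoint : selfadjoint A) (E_A : spectral_measure_of A E).
Implicit Types (D : set (measurableTypeR R)) (u v : H).

Lemma rdot_A u v : rdot (A u) v = rdot u (A v).
Proof. by rewrite /rdot A_selfadjoint. Qed.

Lemma rdot_AE u : rdot (A u) u = \int[scalar_measure E u]_t t.
Proof. by rewrite /rdot (E_A u).2. Qed.

(* The diagonal form is additive along the decomposition, so its polarization
   has no cross terms. *)
Lemma rdot_A_ortho D u v : measurable D -> E D u = u -> E (~` D) v = v ->
  rdot (A u) v = 0.
Proof.
move=> mD Du Dv.
have : rdot (A (u + v)) (u + v) = rdot (A u) u + rdot (A v) v.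
  rewrite !rdot_AE /Rintegral.
  pose mu := measure_add (scalar_measure E u) (scalar_measure E v).
  rewrite (eq_measure_integral mu); last first.
    by move=> S mS _; rewrite [RHS]measure_addE; exact: scalar_measureD mD mS Du Dv.
  have [iu _] := E_A u; have [iv _] := E_A v.
  rewrite integral_measure_add// fineD//; exact: integrable_fin_num.
rewrite linearD !rdot_linE (rdot_A v u) (rdotC v); lra.
Qed.

Lemma sm_comm D u : measurable D -> E D (A u) = A (E D u).
Proof.
have invariant S v : measurable S -> E (~` S) (A (E S v)) = 0.
  move=> mS; have mCS := measurableC mS; apply: rnorm0_eq0; apply/eqP.
  rewrite -sqrf_eq0 -rdotE rdot_sm// sm_idem//; apply/eqP.
  by apply: (rdot_A_ortho mS); rewrite sm_idem.
move=> mD; have mCD := measurableC mD.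
rewrite {1}(sm_decomp E u mD) !linearD.
have := invariant (~` D) u mCD; rewrite setCK => ->; rewrite addr0.
by rewrite [RHS](sm_decomp E _ mD) invariant// addr0.
Qed.

Lemma sm_comm_iter D n u : measurable D -> E D (iter n A u) = iter n A (E D u).
Proof. by move=> mD; elim: n => // n ih; rewrite !iterS sm_comm// ih. Qed.

Lemma integral_range D u : measurable D -> E D u = u ->
  (\int[scalar_measure E u]_t t%:E = \int[scalar_measure E u]_(t in D) t%:E)%E.
Proof.
move=> mD Du; have mCD := measurableC mD.
rewrite (@negligible_integral _ _ _ _ _ (~` D)) ?setTD ?setCK//.
  by have [] := E_A u.
have CDu : E (~` D) u = 0 by rewrite -Du sm_disjoint// setICl.
by rewrite /= /scalar_measure CDu rnorm0 expr0n.
Qed.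

Lemma scalar_integral_cst D u (b : R) : measurable D -> E D u = u ->
  (\int[scalar_measure E u]_(t in D) b%:E = (b * rnorm u ^+ 2)%:E)%E.
Proof. by move=> mD Du; rewrite integral_cst//= /scalar_measure Du. Qed.

Lemma scalar_integrable_cst D u (b : R) : measurable D ->
  (scalar_measure E u).-integrable D (cst b%:E).
Proof.
move=> mD; apply/integrableP; split; first exact: measurable_cst.
by rewrite integral_cst//= -EFinM ltry.
Qed.

Lemma scalar_integrable_id D u : measurable D ->
  (scalar_measure E u).-integrable D (fun t => t%:E).
Proof.
move=> mD; apply: (@integrableS _ _ _ _ setT) => //.
by have [] := E_A u.
Qed.

Lemma rdot_A_le D u (b : R) : measurable D -> (forall t, D t -> t <= b) ->
  E D u = u -> rdot (A u) u <= b * rnorm u ^+ 2.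
Proof.
move=> mD Db Du; rewrite rdot_AE /Rintegral (integral_range mD Du).
rewrite -lee_fin fineK; last first.
  by apply: integrable_fin_num => //; exact: scalar_integrable_id.
rewrite -(scalar_integral_cst b mD Du); apply: le_integral => //.
- exact: scalar_integrable_id.
- exact: scalar_integrable_cst.
- by move=> t; rewrite inE lee_fin; exact: Db.
Qed.

Lemma rdot_A_ge D u (a : R) : measurable D -> (forall t, D t -> a <= t) ->
  E D u = u -> a * rnorm u ^+ 2 <= rdot (A u) u.
Proof.
move=> mD Db Du; rewrite rdot_AE /Rintegral (integral_range mD Du).
rewrite -lee_fin fineK; last first.
  by apply: integrable_fin_num => //; exact: scalar_integrable_id.
rewrite -(scalar_integral_cst a mD Du); apply: le_integral => //.
- exact: scalar_integrable_cst.
- exact: scalar_integrable_id.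
- by move=> t; rewrite inE lee_fin; exact: Db.
Qed.

(** The norm of a selfadjoint operator is governed by its quadratic form. The argument stays inside
    the range of [E D], which [A] preserves. *)
Lemma rnorm_A_le D u (c : R) : 0 <= c -> measurable D ->
  (forall t, D t -> `|t| <= c) -> E D u = u -> rnorm (A u) <= c * rnorm u.
Proof.
move=> c0 mD Dc Du.
have bound w : E D w = w -> `|rdot (A w) w| <= c * rnorm w ^+ 2.
  move=> Dw; rewrite ler_norml -mulNr (rdot_A_ge mD _ Dw) ?(rdot_A_le mD _ Dw)//.
    by move=> t /Dc; rewrite ler_norml => /andP[].
  by move=> t /Dc; rewrite ler_norml => /andP[].
(* Polarization and the parallelogram law. *)
have polar s : 2 * s * rnorm (A u) ^+ 2 <= c * (rnorm u ^+ 2 + s ^+ 2 * rnorm (A u) ^+ 2).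
  have [v vE] : exists v, v = s%:C%C *: A u by eexists.
  have Dv : E D v = v by rewrite vE linearZ/= sm_comm// Du.
  have /ler_normlP[_ bp] : `|rdot (A (u + v)) (u + v)| <= c * rnorm (u + v) ^+ 2.
    by apply: bound; rewrite linearD Du Dv.
  have /ler_normlP[bm _] : `|rdot (A (u - v)) (u - v)| <= c * rnorm (u - v) ^+ 2.
    by apply: bound; rewrite linearB Du Dv.
  move: bp bm; rewrite -!rdotE linearB linearD !rdot_linE.
  rewrite (rdot_A v u) (rdotC v (A u)) (rdotC v u) vE !rdot_linE; nra.
have [c00|cn0] := eqVneq c 0.
  have := polar 1; rewrite c00 !mul0r mulr1 => h.
  have : rnorm (A u) ^+ 2 <= 0 by lra.
  by rewrite -[leRHS](expr0n _ 2) ler_pXn2r// ?nnegrE// rnorm_ge0.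
have cp : 0 < c by rewrite lt_neqAle eq_sym cn0.
rewrite -(ler_pXn2r (ltn0Sn 1)) ?nnegrE ?mulr_ge0 ?rnorm_ge0// exprMn.
(* With s = 1/c, half of the left side of [polar] absorbs the last term, leaving |A u|^2 <= c^2
   |u|^2. *)
have h := polar c^-1.
have -> : rnorm (A u) ^+ 2 = c * (2 * c^-1 * rnorm (A u) ^+ 2)
    - c * c * (c^-1 ^+ 2 * rnorm (A u) ^+ 2) by field.
have : c * (2 * c^-1 * rnorm (A u) ^+ 2) <=
    c * (c * (rnorm u ^+ 2 + c^-1 ^+ 2 * rnorm (A u) ^+ 2)) by rewrite ler_wpM2l.
rewrite expr2; nra.
Qed.

(** On one half-line the quadratic form has a constant sign, so its positive and negative parts
    cannot cancel and Cauchy-Schwarz against [u] suffices. *)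
Lemma rnorm_A_ge D u (c : R) : 0 <= c -> measurable D ->
  (forall t, D t -> c <= t) \/ (forall t, D t -> t <= - c) ->
  E D u = u -> c * rnorm u <= rnorm (A u).
Proof.
move=> c0 mD Dc Du.
have [->|u0] := eqVneq (rnorm u) 0; first by rewrite mulr0 rnorm_ge0.
have up : 0 < rnorm u by rewrite lt_neqAle eq_sym u0 rnorm_ge0.
rewrite -(ler_pM2r up) -mulrA -expr2.
case: Dc => Dc.
  exact: le_trans (rdot_A_ge mD Dc Du) (rdot_le _ _).
have := rdot_A_le mD Dc Du; have := rdot_le (- A u) u.
by rewrite rdotNl /rnorm normrN; lra.
Qed.

Lemma rnorm_iter_le D n u (c : R) : 0 <= c -> measurable D ->
  (forall t, D t -> `|t| <= c) -> E D u = u ->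
  rnorm (iter n A u) <= c ^+ n * rnorm u.
Proof.
move=> c0 mD Dc Du; elim: n => [|n ih]; first by rewrite mul1r.
rewrite iterS exprS -mulrA; apply: (@le_trans _ _ (c * rnorm (iter n A u))).
  by apply: (rnorm_A_le c0 mD Dc); rewrite sm_comm_iter// Du.
by rewrite ler_wpM2l.
Qed.

Lemma rnorm_iter_ge D n u (c : R) : 0 <= c -> measurable D ->
  (forall t, D t -> c <= t) \/ (forall t, D t -> t <= - c) ->
  E D u = u -> c ^+ n * rnorm u <= rnorm (iter n A u).
Proof.
move=> c0 mD Dc Du; elim: n => [|n ih]; first by rewrite mul1r.
rewrite iterS exprS -mulrA; apply: (@le_trans _ _ (c * rnorm (iter n A u))).
  by rewrite ler_wpM2l.
by apply: (rnorm_A_ge c0 mD Dc); rewrite sm_comm_iter// Du.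
Qed.

End spectral_operator.

(** * Numerical bounds for the slicing argument *)

Section elementary_bounds.
Context {R : realType}.

Lemma bernoulli_ineq (e : R) n : 0 <= e <= 1 -> 1 - n%:R * e <= (1 - e) ^+ n.
Proof.
move=> /andP[e0 e1]; elim: n => [|n ih]; first by rewrite mul0r subr0.
rewrite exprS; apply: (@le_trans _ _ ((1 - e) * (1 - n%:R * e))).
  have : 0 <= n%:R * (e * e) by rewrite !mulr_ge0.
  rewrite -natr1; nra.
by rewrite ler_wpM2l// subr_ge0.
Qed.

(** From 1 - t <= exp(-t) the power is at most exp(-j), and exp(1) >= 2. *)
Lemma slice_weight_le (n j : nat) : (j <= n.+1)%N ->
  (1 - j%:R / n.+1%:R) ^+ n.+1 <= (2^-1) ^+ j :> R.
Proof.
move=> jn; have c0 : 0 <= 1 - j%:R / n.+1%:R :> R.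
  by rewrite subr_ge0 ler_pdivrMr ?ltr0n// mul1r ler_nat.
apply: (@le_trans _ _ (expR (- (j%:R / n.+1%:R)) ^+ n.+1)).
  by apply: lerXn2r; rewrite ?nnegrE ?expR_ge0//; exact: expR_ge1Dx.
rewrite -expRM_natl mulrN mulrCA divff ?pnatr_eq0// -mulrN expRM_natl.
apply: lerXn2r; rewrite ?nnegrE ?expR_ge0 ?invr_ge0//.
by rewrite expRN lef_pV2 ?posrE ?expR_gt0//; exact: expR_ge1Dx.
Qed.

Lemma sum_arith_geom_le (n : nat) :
  \sum_(0 <= j < n) (2^-1) ^+ j * j.+1%:R <= 4 :> R.
Proof.
(* The remainder of the series is explicit, which turns the bound into an identity provable by
   induction. *)
suff : \sum_(0 <= j < n) (2^-1) ^+ j * j.+1%:R + 2 * n.+2%:R * (2^-1) ^+ n = 4 :> R.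
  have : 0 <= 2 * n.+2%:R * (2^-1) ^+ n :> R by rewrite !mulr_ge0// exprn_ge0.
  lra.
elim: n => [|n ih]; first by rewrite big_nil; lra.
by rewrite big_nat_recr//= -[RHS]ih exprS -!natr1; field.
Qed.

End elementary_bounds.

(** * Tails of the scalar measure against decay of the iterates *)

Section tails.
Context {R : realType} {H : hilbertType R}.
Variables (A : {linear H -> H}) (E : spectral_measure H).
Hypotheses (A_selfadjoint : selfadjoint A) (E_A : spectral_measure_of A E).
Variable x : H.

Let tail (c : R) : set (measurableTypeR R) := [set t : R | c < `|t|].
Let pos (c : R) : set (measurableTypeR R) := [set` `]c, +oo[].
Let neg (c : R) : set (measurableTypeR R) := [set` `]-oo, (- c)[].

Let mpos c : measurable (pos c). Proof. exact: measurable_itv. Qed.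
Let mneg c : measurable (neg c). Proof. exact: measurable_itv. Qed.

Let tailE c : tail c = pos c `|` neg c.
Proof.
apply/seteqP; split => t; rewrite /tail /pos /neg /= !in_itv/= andbT ltrNr.
  by rewrite ltr_normr => /orP.
by move=> /orP; rewrite -ltr_normr.
Qed.

Lemma measurable_tail (c : R) :
  measurable ([set t : R | c < `|t|] : set (measurableTypeR R)).
Proof. by rewrite -/(tail c) tailE; exact: measurableU. Qed.

Let disjoint_pos_neg c : 0 <= c -> pos c `&` neg c = set0.
Proof.
move=> c0; rewrite -subset0 => t [] /=; rewrite /pos /neg /= !in_itv/= andbT.
lra.
Qed.

Lemma tail_bigO_decayP :
  (exists K : R, forall e, 0 < e -> rnorm (E (tail (1 - e)) x) ^+ 2 <= K * e) <->
  (exists K : R, forall n, rnorm (iter n A x) ^+ 2 <= K / n.+1%:R).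
Proof.
split=> -[K hK]; last first.
  have K0 : 0 <= K by have := hK 0%N; rewrite divr1; apply: le_trans; exact: sqr_ge0.
  (* Each of the two half-lines contributes [8 * K * e], because (3/4)^2 |E D x|^2 <= 4 K e and 64/9
     <= 8. *)
  exists (16 * K) => e e0.
  (* For [e > 1] the level [1 - e] is negative, and |x|^2 <= K, the case [n = 0] of the hypothesis,
     is enough. *)
  have [e1|e1] := leP e 1; last first.
    apply: (@le_trans _ _ K); last by nra.
    have := hK 0%N; rewrite divr1/=; apply: le_trans.
    apply: lerXn2r; rewrite ?nnegrE ?rnorm_ge0//.
    exact: rnorm_sm_le (measurable_tail _).
  set c := 1 - e; have c0 : 0 <= c by rewrite subr_ge0.
  (* Small enough for Bernoulli to give [3 / 4 <= c ^+ n], large enough for [K / n.+1%:R] to be at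
     most [4 * K * e]. *)
  pose n := Num.truncn ((4 * e)^-1).
  have n_le : n%:R * e <= 4^-1.
    have : n%:R <= (4 * e)^-1 by rewrite truncn_le invr_ge0 mulr_ge0// ltW.
    by rewrite invfM -ler_pdivlMr.
  have n_ge : n.+1%:R^-1 <= 4 * e.
    by rewrite invf_ple ?posrE ?ltr0n ?mulr_gt0// ltW// truncnS_gt.
  have half D : measurable D ->
      (forall t, D t -> c <= t) \/ (forall t, D t -> t <= - c) ->
      rnorm (E D x) ^+ 2 <= 8 * K * e.
    move=> mD Dc.
    have := rnorm_iter_ge A_selfadjoint E_A n c0 mD Dc (sm_idem E mD x).
    rewrite -(sm_comm_iter A_selfadjoint E_A)// => h.
    have h2 := rnorm_sm_le E (iter n A x) mD.
    have cn : 3 / 4 <= c ^+ n.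
      apply: le_trans (bernoulli_ineq n _); first by lra.
      by rewrite ltW.
    have Ex : 3 / 4 * rnorm (E D x) <= rnorm (iter n A x).
      by apply: le_trans h2; apply: le_trans h; rewrite ler_wpM2r ?rnorm_ge0.
    have : (3 / 4 * rnorm (E D x)) ^+ 2 <= K * (4 * e).
      apply: (@le_trans _ _ (K / n.+1%:R)); last by rewrite ler_wpM2l.
      apply: le_trans (hK n).
      by apply: lerXn2r; rewrite ?nnegrE ?mulr_ge0 ?rnorm_ge0.
    rewrite exprMn; have : 0 <= K * e by rewrite mulr_ge0// ltW.
    lra.
  have -> : rnorm (E (tail c) x) ^+ 2 =
      rnorm (E (pos c) x) ^+ 2 + rnorm (E (neg c) x) ^+ 2.
    have PN : rdot (E (pos c) x) (E (neg c) x) = 0.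
      by rewrite rdot_sm// sm_disjoint ?disjoint_pos_neg// /rdot linear0r.
    rewrite tailE sm_setU// ?disjoint_pos_neg// -!rdotE !rdot_linE.
    by rewrite (rdotC (E (neg c) x) (E (pos c) x)) PN addr0 add0r.
  have : rnorm (E (pos c) x) ^+ 2 <= 8 * K * e.
    by apply: (half _ (mpos c)); left => t; rewrite /pos/= in_itv/= andbT => /ltW.
  have : rnorm (E (neg c) x) ^+ 2 <= 8 * K * e.
    by apply: (half _ (mneg c)); right => t; rewrite /neg/= in_itv/= => /ltW.
  lra.
have K0 : 0 <= K by have := hK 1 ltr01; rewrite mulr1; apply: le_trans; exact: sqr_ge0.
pose ball c := ~` tail c.
have mball c : measurable (ball c) := measurableC (measurable_tail c).
have ball_le c t : ball c t -> `|t| <= c.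
  by rewrite /ball /tail /= => /negP; rewrite -leNgt.
have ball_sub c d : c <= d -> ball c `&` ball d = ball c.
  move=> cd; apply/setIidPl => t; rewrite /ball /tail /= => /negP; rewrite -leNgt => tc.
  by apply/negP; rewrite -leNgt (le_trans tc).
have sub_tail c : x - E (ball c) x = E (tail c) x.
  by rewrite {1}(sm_decomp E x (measurable_tail c)) addrK.
have tail1 : E (tail 1) x = 0.
  apply: rnorm0_eq0; apply/eqP; rewrite -sqrf_eq0; apply/negP => /negP a0.
  set a := _ ^+ 2 in a0; have ap : 0 < a by rewrite lt_neqAle eq_sym a0 sqr_ge0.
  (* The mass [a] beyond 1 is at most [K * e] for every positive [e]; this choice makes [K * e < a],
     also when [K = 0]. *)
  have e0 : 0 < a / (2 * (K + 1)) by rewrite divr_gt0// mulr_gt0//; lra.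
  have : a <= K * (a / (2 * (K + 1))).
    apply: le_trans (hK _ e0); apply: lerXn2r; rewrite ?nnegrE ?rnorm_ge0//.
    have -> : E (tail 1) x = E (tail 1) (E (tail (1 - a / (2 * (K + 1)))) x).
      rewrite (smI E x (measurable_tail _) (measurable_tail _)).
      congr (E _ x); apply/esym/setIidPl => t; rewrite /tail/=.
      by apply: lt_trans; rewrite ltrBlDr ltrDl.
    exact: rnorm_sm_le (measurable_tail _).
  rewrite mulrCA -subr_ge0.
  have -> : a * (K / (2 * (K + 1))) - a = - (a * (K + 2) / (2 * (K + 1))).
    by field; lra.
  have : 0 < a * (K + 2) / (2 * (K + 1)).
    by rewrite divr_gt0 ?(mulr_gt0 ap) ?mulr_gt0 ?ltr0n//; lra.
  lra.
(* The second term serves [n = 0]; for the other indices [16 * K] is doubled by the shift from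
   [n.+1] to [n.+2]. *)
exists (32 * K + rnorm x ^+ 2) => -[|n].
  by rewrite divr1 /= lerDr; lra.
(* These truncations run from [x] itself, as no mass lies beyond 1, down to the component at t = 0,
   which [A] annihilates. Their successive differences are the slices of [x]. *)
pose z j := E (ball (1 - j%:R / n.+1%:R)) x.
have z0 : z 0%N = x.
  by rewrite /z mul0r subr0; apply/esym/eqP; rewrite -subr_eq0 sub_tail tail1.
have zn : iter n.+1 A (z n.+1) = 0.
  apply: rnorm0_eq0; apply/eqP; rewrite eq_le rnorm_ge0 andbT.
  have := rnorm_iter_le A_selfadjoint E_A n.+1 (lexx 0) (mball 0) (@ball_le 0).
  move=> /(_ (z n.+1)); rewrite exprS !mul0r; apply.
  by rewrite /z divff ?pnatr_eq0// subrr sm_idem.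
(* The outer radius [c] gives the contraction factor and the inner radius [d] the tail bound. The
   square root of [j.+1] is relaxed to [j.+1], so that [sum_arith_geom_le] applies. *)
have slice j : (j < n.+1)%N -> rnorm (iter n.+1 A (z j - z j.+1)) <=
    Num.sqrt (K / n.+1%:R) * ((2^-1) ^+ j * j.+1%:R).
  move=> jn; set c : R := 1 - j%:R / n.+1%:R.
  set d : R := 1 - j.+1%:R / n.+1%:R.
  have dc : d <= c by rewrite lerD2l lerN2 ler_pM2r ?invr_gt0 ?ltr0n// ler_nat.
  have c0 : 0 <= c by rewrite subr_ge0 ler_pdivrMr ?ltr0n// mul1r ler_nat ltnW.
  have zE : z j - z j.+1 = E (ball c) (E (tail d) x).
    by rewrite -sub_tail linearB/= (smI E x (mball c) (mball d)) setIC ball_sub.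
  have Ez : E (ball c) (z j - z j.+1) = z j - z j.+1 by rewrite zE sm_idem.
  apply: (le_trans (rnorm_iter_le A_selfadjoint E_A n.+1 c0 (mball c) (@ball_le c) Ez)).
  rewrite [leRHS]mulrCA; apply: ler_pM; rewrite ?rnorm_ge0 ?exprn_ge0//.
    by apply: slice_weight_le; exact: ltnW.
  rewrite zE; apply: (le_trans (rnorm_sm_le _ _ (mball c))).
  rewrite -(ler_pXn2r (ltn0Sn 1)) ?nnegrE ?rnorm_ge0 ?mulr_ge0 ?sqrtr_ge0//.
  rewrite exprMn sqr_sqrtr ?divr_ge0//; apply: (@le_trans _ _ (K * (j.+1%:R / n.+1%:R))).
    by apply: hK; rewrite divr_gt0 ?ltr0n.
  rewrite mulrA [leRHS]mulrAC ler_pM2r ?invr_gt0 ?ltr0n// ler_wpM2l// expr2.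
  by rewrite ler_peMr// ler1n.
have iterB m u v : iter m A (u - v) = iter m A u - iter m A v.
  by elim: m => // m ih; rewrite !iterS ih linearB.
have Ax : iter n.+1 A x = \sum_(0 <= j < n.+1) iter n.+1 A (z j - z j.+1).
  rewrite (eq_bigr (fun j => - (iter n.+1 A (z j.+1) - iter n.+1 A (z j)))); last first.
    by move=> j _; rewrite iterB opprB.
  by rewrite sumrN telescope_sumr// zn z0 sub0r opprK.
have Ax_le : rnorm (iter n.+1 A x) <= Num.sqrt (K / n.+1%:R) * 4.
  rewrite Ax; apply: (le_trans (ler_rnorm_sum _ _)).
  apply: (@le_trans _ _ (Num.sqrt (K / n.+1%:R) *
      \sum_(0 <= j < n.+1) (2^-1) ^+ j * j.+1%:R)).
    by rewrite mulr_sumr; apply: ler_sum_nat => j /andP[_]; exact: slice.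
  by rewrite ler_wpM2l ?sqrtr_ge0// sum_arith_geom_le.
have : rnorm (iter n.+1 A x) ^+ 2 <= 16 * (K / n.+1%:R).
  have -> : 16 * (K / n.+1%:R) = (Num.sqrt (K / n.+1%:R) * 4) ^+ 2.
    by rewrite exprMn sqr_sqrtr ?divr_ge0//; ring.
  by apply: lerXn2r; rewrite ?nnegrE ?rnorm_ge0 ?mulr_ge0 ?sqrtr_ge0.
move=> /le_trans; apply; rewrite mulrA ler_pdivrMr ?ltr0n// mulrAC ler_pdivlMr ?ltr0n//.
apply: (@le_trans _ _ (32 * K * n.+1%:R)); last by rewrite ler_wpM2r// lerDl sqr_ge0.
have : n.+2%:R <= 2 * n.+1%:R :> R by rewrite -natrM ler_nat; lia.
nra.
Qed.

End tails.

Theorem theorem3p5 (R : realType) (H : hilbertType R)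
    (A : {linear H -> H}) (A_bounded : bounded_near A (nbhs (0 : H)))
    (A_selfadjoint : selfadjoint A)
    (E : spectral_measure H) (E_A : spectral_measure_of A E) (x : H) :
  [<-> bessel_seq (fun k : nat => iter k A x);
       (fun e : R => fine (scalar_measure E x [set t : R | 1 - e < `|t|]))
         =O_ ((0 : R)^'+) (fun e : R => e);
       (fun k : nat => inner (iter k A x) x : R[i]^o)
         =O_\oo (fun k : nat => k%:R^-1 : R[i]^o)].
Proof.
(* [m] is convertible to the function in the second condition, so [tailP] applies to it directly. It
   is bounded by |x|^2, as [bigO_right0P] requires. *)
pose m (e : R) := rnorm (E [set t : R | 1 - e < `|t|] x) ^+ 2.
have tailP : m =O_ ((0 : R)^'+) (fun e : R => e) <->
    exists K : R, forall n, rnorm (iter n A x) ^+ 2 <= K / n.+1%:R.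
  rewrite (@bigO_right0P _ m (rnorm x ^+ 2)); first exact: tail_bigO_decayP.
  move=> e; rewrite sqr_ge0/=; apply: lerXn2r; rewrite ?nnegrE ?rnorm_ge0//.
  by apply: rnorm_sm_le; exact: measurable_tail.
tfae.
- by move=> /(bessel_rnorm_decay A_selfadjoint) /tailP.
- move=> /tailP /(moments_decayP A_selfadjoint x).
  exact: (bigO_inv_natP _).2.
- by move=> /bigO_inv_natP /(moments_decay_bessel A_selfadjoint).
Qed.
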